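(* Let $S$ be a core factorable right LCM semigroup such that $S_{ci}\subset S$ is $\cap$-closed, and fix a transversal $\mathcal{T}$ for $S/_\sim$ with $\mathcal{T}\subset S_{ci}^1$ and the associated maps $i\colon S\to\mathcal{T}$, $c\colon S\to S_c$ determined by $s=i(s)c(s)$. Let $M:=\bigoplus_{t\in\mathcal{T}}C^*(S_c)$ be the direct sum of the standard right Hilbert $C^*(S_c)$-module. Suppose $\rho$ is a state on $C^*(S_c)$ with GNS-representation $(\pi'_\rho,\mathcal{H}'_\rho,\xi_\rho)$. Form the Hilbert space $\mathcal{H}_\rho:=M\otimes_{C^*(S_c)}\mathcal{H}'_\rho$. The linear operator $V_s\colon\mathcal{H}_\rho\to\mathcal{H}_\rho$ given by $$V_s(\xi_ty\otimes\xi_\rho):=\xi_{i(st)}w_{c(st)}y\otimes\xi_\rho$$ for $t\in\mathcal{T}$, $y\in C^*(S_c)$, is adjointable for all $s\in S$. The family $(V_s)_{s\in S}$ gives rise to a representation $\pi_\rho\colon C^*(S)\to\mathcal{L}(\mathcal{H}_\rho)$ (with $\pi_\rho(v_s)=V_s$ for $s\in S$).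
   Context: All semigroups are countable discrete monoids. **Right LCM semigroups.** A monoid $S$ is right LCM if it is left cancellative and for all $s,t\in S$ the set $sS\cap tS$ is empty or of the form $rS$; such $r$ is a right LCM of $s,t$. $S^*$ is the group of invertible elements; $s\perp t$ means $sS\cap tS=\emptyset$. $S_c=\{a\in S: aS\cap sS\ne\emptyset\ \forall s\in S\}$ (itself right LCM). $S_{ci}$ is the set of $s\in S\setminus S_c$ such that every factorisation $s=ta$ with $a\in S_c$ forces $a\in S^*$; $S_{ci}^1=S_{ci}\cup\{1\}$. $s\sim t$ means $sa=tb$ for some $a,b\in S_c$. $S$ is core factorable if $S=S_{ci}^1S_c$; $S_{ci}\subset S$ is $\cap$-closed if any right LCM in $S$ of two elements of $S_{ci}$ belongs to $S_{ci}$. A transversal for $S/_\sim$ is a minimal complete set of representatives. Under these two assumptions a transversal $\mathcal{T}\subset S_{ci}^1$ for $S/_\sim$ exists, and every $s\in S$ can be written uniquely as $s=i(s)c(s)$ with $i(s)\in\mathcal{T}$, $c(s)\in S_c$. **$C^*$-algebras.** $C^*(S)$ is the universal $C^*$-algebra generated by an isometric representation $v$ of $S$ with $v_s^*v_t=v_{s'}v_{t'}^*$ if $sS\cap tS=ss'S$, $ss'=tt'$, and $v_s^*v_t=0$ if $s\perp t$. The generating isometries of $C^*(S_c)$ are denoted $w_a$, $a\in S_c$. **Tensor products.** $C^*(S_c)$ is a right Hilbert module over itself with $\langle y,z\rangle=y^*z$. For a right Hilbert $A$-module $X$ and a representation $\pi$ of $A$ on a Hilbert space $H$, $X\otimes_AH$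 is the Hilbert space completion of the algebraic tensor product balanced over $A$ with inner product characterised by $\langle x\otimes h,y\otimes k\rangle=\langle\pi(\langle y,x\rangle)h,k\rangle$. For $t\in\mathcal{T}$, $\xi_t$ denotes the image of $1\in C^*(S_c)$ in the $t$-th summand of $M$. *)

(* Defs.v *)
From HB Require Import structures.
From mathcomp Require Import all_boot all_order all_algebra.
From mathcomp Require Import sesquilinear complex.
From mathcomp Require Import boolp classical_sets reals topology normedtype.
From mathcomp Require Import summability.

Set Implicit Arguments.
Unset Strict Implicit.
Unset Printing Implicit Defensive.

Import Order.TTheory GRing.Theory Num.Theory.

Local Open Scope classical_set_scope.
Local Open Scope ring_scope.

Section RightLCM.
Variable S : monoidType.
Local Open Scope group_scope.
Implicit Types s t r a : S.

Definition principal_ideal s : set S := [set s * x | x in [set: S]].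

Definition is_right_lcm r s t : Prop :=
  principal_ideal s `&` principal_ideal t = principal_ideal r.

Definition ideal_orthogonal s t : Prop :=
  principal_ideal s `&` principal_ideal t = set0.

Definition right_lcm_semigroup : Prop :=
  (forall s, injective (fun x => s * x)) /\
  (forall s t, ideal_orthogonal s t \/ exists r, is_right_lcm r s t).

Definition invertible s : Prop := exists t, s * t = 1 /\ t * s = 1.

Definition core : pred S :=
  fun a => `[< forall s, principal_ideal a `&` principal_ideal s !=set0 >].

Lemma core_closed : monoid_closed core.
Proof.
split=> [|a b /asboolP ca /asboolP cb]; apply/asboolP => s.
  by exists s; split; [exists s => //; rewrite mul1g | exists 1 => //; rewrite mulg1].
have [_ [[x _ <-] [y _ syax]]] := ca s.
have [_ [[z _ <-] [u _ xubz]]] := cb x.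
exists (a * b * z); split; first by exists z.
by exists (y * u) => //; rewrite mulgA syax -!mulgA xubz.
Qed.

Definition core_irreducible s : Prop :=
  ~~ core s /\ (forall t a, core a -> s = t * a -> invertible a).

Definition core_irreducible1 s : Prop := core_irreducible s \/ s = 1.

Definition core_equiv s t : Prop :=
  exists a b, [/\ core a, core b & s * a = t * b].

Definition core_factorable : Prop :=
  forall s, exists t a, [/\ core_irreducible1 t, core a & s = t * a].

Definition core_irreducible_cap_closed : Prop :=
  forall s t r, core_irreducible s -> core_irreducible t ->
  is_right_lcm r s t -> core_irreducible r.

Definition transversal_core_equiv (T : set S) : Prop :=
  (forall s, exists2 t, T t & core_equiv s t) /\
  (forall t u, T t -> T u -> core_equiv t u -> t = u).

End RightLCM.

Record core_monoid (S : monoidType) : Type := CoreMonoid {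
  core_val :> S;
  core_valP : core core_val
}.

HB.instance Definition _ (S : monoidType) := [isSub for @core_val S].
HB.instance Definition _ (S : monoidType) :=
  [Choice of core_monoid S by <:].
HB.instance Definition _ (S : monoidType) :=
  SubChoice_isSubMonoid.Build S (@core S) (core_monoid S) (@core_closed S).

(* Unital C*-algebras. The library cannot join its ring structures with
   completeNormedModType, hence the separate multiplication. Norms take their
   values in R[i], where 0 <= z means that z is real and nonnegative. *)
HB.mixin Record isCStarAlgebra (R : realType) A & CompleteNormedModule R[i] A := {
  cmul : A -> A -> A;
  cone : A;
  star : A -> A;
  cmulA : associative cmul;
  cmul1l : left_id cone cmul;
  cmul1r : right_id cone cmul;
  cmulDl : left_distributive cmul +%R;
  cmulDr : right_distributive cmul +%R;
  cmulZl : forall (k : R[i]) (x y : A), cmul (k *: x) y = k *: cmul x y;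
  cmulZr : forall (k : R[i]) (x y : A), cmul x (k *: y) = k *: cmul x y;
  starD : forall x y : A, star (x + y) = star x + star y;
  starZ : forall (k : R[i]) (x : A), star (k *: x) = Num.conj k *: star x;
  starM : forall x y : A, star (cmul x y) = cmul (star y) (star x);
  starK : involutive star;
  cstar_normM : forall x y : A, `|cmul x y| <= `|x| * `|y|;
  cstar_identity : forall x : A, `|cmul (star x) x| = `|x| ^+ 2
}.

#[short(type="cstarAlgType")]
HB.structure Definition CStarAlgebra (R : realType) :=
  {A of CompleteNormedModule R[i] A & isCStarAlgebra R A}.

Arguments cone {R s}.

Reserved Notation "x *c y" (at level 40, left associativity).
Notation "x *c y" := (cmul x y) : ring_scope.

Definition star_morphism (R : realType) (A B : cstarAlgType R) (f : A -> B)
    : Prop :=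
  [/\ linear f, f cone = cone, {morph f : x y / x *c y}
    & {morph f : x / star x}].

(* Isometric representations respecting right LCMs. *)
Definition lcm_representation (R : realType) (P : monoidType)
    (A : cstarAlgType R) (v : P -> A) : Prop :=
  [/\ v 1%g = cone,
      forall s t, v (s * t)%g = v s *c v t,
      forall s, star (v s) *c v s = cone,
      forall s t s' t', is_right_lcm (s * s')%g s t ->
        (s * s' = t * t')%g -> star (v s) *c v t = v s' *c star (v t')
    & forall s t, ideal_orthogonal s t -> star (v s) *c v t = 0].

(* (A, v) is C^*(P) with its generating isometries; uniqueness of the induced
   morphism expresses that A is generated by the range of v. *)
Definition is_semigroup_cstar_algebra (R : realType) (P : monoidType)
    (A : cstarAlgType R) (v : P -> A) : Prop :=
  lcm_representation v /\
  forall (B : cstarAlgType R) (u : P -> B), lcm_representation u ->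
    exists! f : A -> B, star_morphism f /\ forall s, f (v s) = u s.

Definition is_state (R : realType) (A : cstarAlgType R) (rho : A -> R[i])
    : Prop :=
  [/\ scalar rho, forall a, 0 <= rho (star a *c a),
      forall a, `|rho a| <= `|a| & rho cone = 1].

(* The inner product is linear in its first argument. *)
HB.mixin Record isHilbert (R : realType) H & CompleteNormedModule R[i] H := {
  inner : {dot H for (@Num.conj R[i])};
  norm_inner : forall x : H, `|x| ^+ 2 = inner x x
}.

#[short(type="hilbertType")]
HB.structure Definition Hilbert (R : realType) :=
  {H of CompleteNormedModule R[i] H & isHilbert R H}.

Definition adjointable (R : realType) (H : hilbertType R) (f : H -> H) : Prop :=
  exists g : H -> H, forall x y, inner (f x) y = inner x (g y).

(* pi is a unital *-homomorphism from A to the adjointable operators on H; the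
   last clause says that pi (star a) is the adjoint of pi a. *)
Definition is_representation (R : realType) (A : cstarAlgType R)
    (H : hilbertType R) (pi : A -> H -> H) : Prop :=
  [/\ forall a, linear (pi a),
      forall (k : R[i]) a b h, pi (k *: a + b) h = k *: pi a h + pi b h,
      forall h, pi cone h = h,
      forall a b h, pi (a *c b) h = pi a (pi b h)
    & forall a h k, inner (pi a h) k = inner h (pi (star a) k)].

Definition is_gns (R : realType) (A : cstarAlgType R) (rho : A -> R[i])
    (H : hilbertType R) (pi : A -> H -> H) (xi : H) : Prop :=
  [/\ is_representation pi, dense [set pi a xi | a in [set: A]]
    & forall a, inner (pi a xi) xi = rho a].

(* Right Hilbert A-modules: the action is hact and the A-valued inner product
   hinner is linear in its second argument. *)
HB.mixin Record isHilbertModule (R : realType) (A : cstarAlgType R) X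
    & CompleteNormedModule R[i] X := {
  hact : X -> A -> X;
  hinner : X -> X -> A;
  hactDl : forall x y a, hact (x + y) a = hact x a + hact y a;
  hactDr : forall x a b, hact x (a + b) = hact x a + hact x b;
  hactZl : forall (k : R[i]) x a, hact (k *: x) a = k *: hact x a;
  hactZr : forall (k : R[i]) x a, hact x (k *: a) = k *: hact x a;
  hactA : forall x a b, hact x (a *c b) = hact (hact x a) b;
  hact1 : forall x, hact x cone = x;
  hinnerDr : forall x y z, hinner x (y + z) = hinner x y + hinner x z;
  hinnerZr : forall (k : R[i]) x y, hinner x (k *: y) = k *: hinner x y;
  hinner_act : forall x y a, hinner x (hact y a) = hinner x y *c a;
  star_hinner : forall x y, star (hinner x y) = hinner y x;
  hinner_ge0 : forall x, exists b : A, hinner x x = star b *c b;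
  norm_hinner : forall x : X, `|x| ^+ 2 = `|hinner x x|
}.

#[short(type="hilbertModType")]
HB.structure Definition HilbertModule (R : realType) (A : cstarAlgType R) :=
  {X of CompleteNormedModule R[i] X & isHilbertModule R A X}.

(* A as a right Hilbert module over itself. *)
Definition standard_module (R : realType) (A : cstarAlgType R) : Type := A.

Section StandardModule.
Variables (R : realType) (A : cstarAlgType R).

HB.instance Definition _ := CompleteNormedModule.on (standard_module A).

Let act (x : standard_module A) (a : A) : standard_module A := (x : A) *c a.
Let ip (x y : standard_module A) : A := star (x : A) *c (y : A).

Let star_ip x y : star (ip x y) = ip y x.
Proof. by rewrite /ip starM starK. Qed.

Let norm_ip (x : standard_module A) : `|x| ^+ 2 = `|ip x x|.
Proof. by rewrite /ip cstar_identity. Qed.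

HB.instance Definition _ :=
  @isHilbertModule.Build R A (standard_module A) act ip
    (fun x y a => @cmulDl R A x y a) (fun x a b => @cmulDr R A x a b)
    (fun k x a => @cmulZl R A k x a) (fun k x a => @cmulZr R A k x a)
    (fun x a b => @cmulA R A x a b) (fun x => @cmul1r R A x)
    (fun x y z => @cmulDr R A (star (x : A)) y z)
    (fun k x y => @cmulZr R A k (star (x : A)) y)
    (fun x y a => @cmulA R A (star (x : A)) y a)
    star_ip (fun x => ex_intro _ (x : A) erefl) norm_ip.

End StandardModule.

(* M is the direct sum of the modules X t: through the coordinate map it is
   the module of all families f such that the sum of the <f t, f t> converges
   in norm, unordered sums being limits over the finite subsets of T. *)
Definition is_direct_sum (R : realType) (A : cstarAlgType R) (T : choiceType)
    (X : T -> hilbertModType A) (M : hilbertModType A)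
    (coord : M -> forall t, X t) : Prop :=
  [/\ forall t, linear (fun x => coord x t),
      forall x a t, coord (hact x a) t = hact (coord x t) a,
      injective coord,
      range coord =
        [set f | cvg (partial_sum (fun t => hinner (f t) (f t)) @ totally)]
    & forall x y, partial_sum (fun t => hinner (coord x t) (coord y t)) @ totally
        --> hinner x y].

(* K, with tens x h playing the role of x (x) h, is the interior tensor product
   of X and H along pi. *)
Definition is_tensor_product (R : realType) (A : cstarAlgType R)
    (X : hilbertModType A) (H : hilbertType R) (pi : A -> H -> H)
    (K : hilbertType R) (tens : X -> H -> K) : Prop :=
  [/\ forall h, linear (tens^~ h),
      forall x, linear (tens x),
      forall x a h, tens (hact x a) h = tens x (pi a h),
      forall x y h k,
        inner (tens x h) (tens y k) = inner (pi (hinner y x) h) k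
    & dense [set z | exists n (x : 'I_n -> X) (h : 'I_n -> H),
        z = \sum_(j < n) tens (x j) (h j)]].

(* Main.v *)
Require Import Defs.
From HB Require Import structures.
From mathcomp Require Import all_boot all_order all_algebra finmap.
From mathcomp Require Import sesquilinear complex.
From mathcomp Require Import boolp classical_sets cardinality reals topology.
From mathcomp Require Import normedtype summability.

(** Write e t y for the vector (xi_t y) (x) xi_rho of H. Two facts about these
    vectors carry everything: their Gram matrix is
    <e t y, e u z> = rho (z^* y) if t = u and 0 otherwise ([elementary_gram]),
    and they span a dense subspace ([elementary_dense]).

    The prescribed formula sends e t y to e (i (st)) (w_{c (st)} y). Left
    cancellation makes t |-> i (st) injective on the transversal
    ([i_mul_inj]), and w_{c (st)} is an isometry, so the formula preserves the
    Gram matrix and extends to an isometry V_s of H. The adjoint has to send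
    e u z to e t (w_{c (st)}^* z) when u = i (st), and to 0 when u has no such
    form; a bound by duality extends this formula from the dense subspace to all
    of H ([gram_operator], [shift_operator]).

    The relations of C^*(S) are then compared on the vectors e t y
    ([shift_lcm_representation]). Multiplicativity is the cocycle identity
    [ic_mul]. If s and t have no common multiple, then i (sq) never equals i (tr)
    ([i_mul_orthogonal]), so the ranges of V_s and V_t are orthogonal. If
    ss' = tt' is a right LCM of s and t, then i (sq) = i (tr) happens exactly when
    q = i (s'p) and r = i (t'p) for a common p, and in that case
    c (sq) c (s'p) = c (tr) c (t'p) is a right LCM of c (sq) and c (tr) in the
    core ([i_mul_lcm]); thus V_s^* V_t = V_{s'} V_{t'}^* is the corresponding
    relation between the w_a. The bounded adjointable operators on H form a
    C*-algebra, and the universal property of C^*(S) gives the representation.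

    Density of the span has two ingredients. An element of the direct sum is the
    limit of its finite truncations ([truncation_cvg]), and x (x) h depends
    continuously on x and on h. The latter needs the GNS representation to be
    contractive ([gns_contractive]), which follows from |rho a| <= |a| by a
    growth estimate for the powers of b^* b. *)

Set Implicit Arguments.
Unset Strict Implicit.
Unset Printing Implicit Defensive.

Import Order.TTheory GRing.Theory Num.Theory.

Local Open Scope classical_set_scope.
Local Open Scope ring_scope.

(** * Inner products *)

Section InnerProduct.
Variables (R : realType) (H : hilbertType R).
Implicit Types x y z : H.

Lemma innerDl x y z : inner (x + y) z = inner x z + inner y z.
Proof. exact: linearDl. Qed.

Lemma innerZl (k : R[i]) x z : inner (k *: x) z = k * inner x z.
Proof. exact: linearZl_LR. Qed.

Lemma innerDr x y z : inner z (x + y) = inner z x + inner z y.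
Proof. exact: linearDr. Qed.

Lemma innerZr (k : R[i]) x z : inner z (k *: x) = Num.conj k * inner z x.
Proof. exact: linearZr_LR. Qed.

Lemma innerC x y : inner x y = Num.conj (inner y x).
Proof. by rewrite hermC/= expr0 mul1r. Qed.

Lemma innerBl x y z : inner (x - y) z = inner x z - inner y z.
Proof. exact: linearBl. Qed.

Lemma innerBr x y z : inner z (x - y) = inner z x - inner z y.
Proof. exact: linearBr. Qed.

Lemma inner0l z : inner 0 z = 0. Proof. exact: linear0l. Qed.

Lemma inner0r z : inner z 0 = 0. Proof. exact: linear0r. Qed.

Lemma inner_suml (I : Type) (r : seq I) (f : I -> H) z :
  inner (\sum_(k <- r) f k) z = \sum_(k <- r) inner (f k) z.
Proof.
by elim/big_rec2: _ => [|k a b _ <-]; [exact: inner0l | rewrite innerDl].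
Qed.

Lemma inner_eq0 x : inner x x = 0 -> x = 0.
Proof. by rewrite -norm_inner => /eqP; rewrite expf_eq0 normr_eq0 => /eqP. Qed.

Lemma inner_extl x y : (forall z, inner x z = inner y z) -> x = y.
Proof.
move=> xy; apply/eqP; rewrite -subr_eq0; apply/eqP/inner_eq0.
by rewrite innerBl xy subrr.
Qed.

Lemma cauchy_schwarz x y : `|inner x y| <= `|x| * `|y|.
Proof.
have [->|y0] := eqVneq y 0; first by rewrite inner0r normr0 mulr_ge0.
have yy0 : inner y y != 0 by rewrite -norm_inner expf_eq0 /= normr_eq0.
pose a := inner x y / inner y y.
have [z xE zy] : exists2 z, x = z + a *: y & inner z y = 0.
  exists (x - a *: y); first by rewrite subrK.
  by rewrite innerBl innerZl divfK// subrr.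
have : `|x| ^+ 2 = `|z| ^+ 2 + `|a| ^+ 2 * `|y| ^+ 2.
  rewrite !norm_inner {1 2}xE innerDl !innerDr !innerZr !innerZl zy mulr0 addr0.
  by rewrite (innerC y z) zy conjC0 !mulr0 add0r (normCK a) mulrCA mulrA.
move=> xn; rewrite -(@ler_pXn2r _ 2) ?nnegrE ?mulr_ge0// exprMn xn mulrDl.
have -> : `|inner x y| ^+ 2 = `|a| ^+ 2 * `|y| ^+ 2 * `|y| ^+ 2.
  rewrite norm_inner normrM exprMn normrV ?unitfE// exprVn.
  rewrite -(norm_inner y) normrX normr_id -!exprM -mulrA -exprD.
  by rewrite divfK// expf_eq0 normr_eq0.
by rewrite lerDr mulr_ge0// exprn_ge0.
Qed.

(** The form in which the norm of a vector is recovered from its inner products: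
    the bound at x = y is |y|^2 <= C |y|. *)
Lemma norm_le_dual (C : R[i]) y :
  0 <= C -> (forall x, `|inner x y| <= C * `|x|) -> `|y| <= C.
Proof.
move=> C0 Cy; have [->|y0] := eqVneq y 0; first by rewrite normr0.
have := Cy y; rewrite -norm_inner normrX normr_id expr2 ler_pM2r//.
by rewrite normr_gt0.
Qed.

End InnerProduct.

(** * Dense subspaces and bounded extension *)

Section DenseExtension.
Variable K : numFieldType.

Lemma le_mul_eps (C x y : K) :
  0 <= C -> (forall e, 0 < e -> x <= y + C * e) -> x <= y.
Proof.
move=> C0 xy; apply/ler_addgt0Pr => e e0.
have C1 : 0 < C + 1 by rewrite ltr_wpDl.
apply: le_trans (xy (e / (C + 1)) _) _; first exact: divr_gt0.
rewrite lerD2l mulrCA ger_pMr// ler_pdivrMr// mul1r lerDl; exact: ler01.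
Qed.

Lemma denseP (V : normedModType K) (D : set V) :
  dense D <-> forall x e, 0 < e -> exists2 d, D d & `|x - d| < e.
Proof.
split=> [dD x e e0|dD O [x Ox] oO].
  have [] := dD (ball x e)^°.
  - by exists x; apply: nbhsx_ballx.
  - exact: open_interior.
  - by move=> d [/interior_subset]; rewrite -ball_normE /= => xd Dd; exists d.
have : nbhs x O by exact: open_nbhs_nbhs.
move=> /nbhs_ballP[e /= e0 xO]; have [d Dd xd] := dD x e e0.
by exists d; split=> //; apply: xO; rewrite -ball_normE.
Qed.

(** Stated for a normed group as target so that it applies to scalar valued maps
    such as x |-> <V x, y> - <x, z>, which is how adjoint identities are passed
    from a dense set to the whole space. *)
Lemma dense_vanish (V : normedModType K) (W : normedZmodType K) (D : set V)
    (f : V -> W) (C : K) :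
    0 <= C -> (forall x y, f (x - y) = f x - f y) ->
    (forall x, `|f x| <= C * `|x|) ->
  dense D -> (forall d, D d -> f d = 0) -> forall x, f x = 0.
Proof.
move=> C0 fB fC /denseP dD fD x; apply/eqP; rewrite -normr_le0.
apply: (le_mul_eps C0) => e e0; rewrite add0r.
have [d Dd xd] := dD x e e0; rewrite -[f x]subr0 -(fD d Dd) -fB.
by apply: le_trans (fC _) _; rewrite ler_wpM2l// ltW.
Qed.

Lemma dense_continuous_ext (V W : normedModType K) (D : set V) (f g : V -> W) :
  continuous f -> continuous g -> dense D ->
  (forall d, D d -> f d = g d) -> f = g.
Proof.
move=> cf cg /denseP dD fg; apply/funext => x; apply/eqP.
rewrite -subr_eq0 -normr_le0; apply: (@le_mul_eps (1 + 1)) => [|e e0].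
  by rewrite addr_ge0.
have /cvgrPdist_lt/(_ e e0) fx := cf x.
have /cvgrPdist_lt/(_ e e0) gx := cg x.
have [r /= r0 xr] := (nbhs_ballP x _).1 (filterI fx gx).
have [d Dd xd] := dD x r r0.
have [fd gd] : `|f x - f d| < e /\ `|g x - g d| < e.
  by apply: xr; rewrite -ball_normE.
rewrite add0r mulrDl mul1r -(subrKA (f d)); apply: le_trans (ler_normD _ _) _.
by rewrite lerD ?(ltW fd)// fg// distrC ltW.
Qed.

Lemma bounded_continuous (V W : normedModType K) (f : V -> W) (C : K) :
    0 <= C -> (forall x y, f (x - y) = f x - f y) ->
  (forall x, `|f x| <= C * `|x|) -> continuous f.
Proof.
move=> C0 fB fC x; apply/cvgrPdist_lt => e e0.
have C1 : 0 < C + 1 by rewrite ltr_wpDl.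
apply/nbhs_ballP; exists (e / (C + 1)); first exact: divr_gt0.
move=> y; rewrite -ball_normE /= => xy; rewrite -fB.
apply: le_lt_trans (fC _) _; apply: le_lt_trans (ler_wpM2l C0 (ltW xy)) _.
by rewrite mulrCA gtr_pMr// ltr_pdivrMr// mul1r ltrDl.
Qed.

Lemma closure_normP (V : normedModType K) (D : set V) x :
  closure D x <-> forall e, 0 < e -> exists2 d, D d & `|x - d| < e.
Proof.
split=> [Dx e e0|Dx O /nbhs_ballP[e /= e0 xO]].
  have [d [Dd]] := Dx (ball x e) (nbhsx_ballx x e e0).
  by rewrite -ball_normE; exists d.
have [d Dd xd] := Dx e e0; exists d; split=> //.
by apply: xO; rewrite -ball_normE.
Qed.

(** A partially defined linear map is given by its graph. Single-valuedness is
    left out: it follows from a norm bound. *)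
Definition linear_graph (V W : lmodType K) (G : V -> W -> Prop) : Prop :=
  forall k x y x' y', G x x' -> G y y' -> G (k *: x + y) (k *: x' + y').

Section Graph.
Variables (V : normedModType K) (W : completeNormedModType K).
Variables (G : V -> W -> Prop) (C : K).
Hypothesis C0 : 0 <= C.
Hypothesis GL : linear_graph G.
Hypothesis GC : forall x y, G x y -> `|y| <= C * `|x|.
Hypothesis Gd : dense [set x | exists y, G x y].

Let GB x y x' y' : G x y -> G x' y' -> G (x - x') (y - y').
Proof.
move=> g g'; have := GL (-1) g' g.
by rewrite !scaleN1r addrC [- y' + _]addrC.
Qed.

(* The closure of G in the product of V and W. *)
Let clG x y := forall e, 0 < e ->
  exists a b, [/\ G a b, `|x - a| < e & `|y - b| < e].

Let clG_ex x : exists y, clG x y.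
Proof.
have /denseP dG := Gd; pose D := [set x | exists y, G x y].
have [phi phiP] : exists phi : V -> W, forall d, D d -> G d (phi d).
  have /choice[phi phiP] : forall d, exists y, D d -> G d y.
    move=> d; have [[y Gy]|nD] := pselect (D d); first by exists y.
    by exists 0.
  by exists phi.
have FP : ProperFilter (within D (nbhs x)).
  apply: within_nbhs_proper; rewrite closureEnbhs /= => A B AD.
  move=> /nbhs_ballP[e /= e0 xB].
  have [d Dd xd] := dG x e e0; exists d; split; first exact: AD.
  by apply: xB; rewrite -ball_normE.
have near_x e : 0 < e -> \forall d \near within D (nbhs x), D d /\ `|x - d| < e.
  move=> e0; apply/nbhs_ballP; exists e => //= d; rewrite -ball_normE /=.
  by [].
(* Since G is bounded by C, the values phi d oscillate by at most 2 C r when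
   d ranges over the ball of radius r. *)
have cau : cauchy (phi @ within D (nbhs x)).
  apply: cauchy_exP => e e0.
  pose r := e / (C + C + 1).
  have C1 : 0 < C + C + 1 by rewrite ltr_wpDl// addr_ge0.
  have r0 : 0 < r by exact: divr_gt0.
  have [d0 Dd0 xd0] := dG x r r0; exists (phi d0).
  apply: filterS (near_x r r0) => d [Dd xd].
  rewrite /= -ball_normE /=.
  apply: le_lt_trans (GC (GB (phiP _ Dd0) (phiP _ Dd))) _.
  have dd : `|d0 - d| <= r + r.
    rewrite -(subrKA x d0 (- d)); apply: le_trans (ler_normD _ _) _.
    by rewrite lerD// ltW// distrC.
  apply: le_lt_trans (ler_wpM2l C0 dd) _.
  by rewrite mulrDr -mulrDl mulrCA gtr_pMr// ltr_pdivrMr// mul1r ltrDl.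
have FF : ProperFilter (phi @ within D (nbhs x)) by exact: fmap_proper_filter.
have [y] : exists y : W, phi @ within D (nbhs x) --> y.
  by exists (lim (phi @ within D (nbhs x))); exact: (cauchy_cvg _ cau).
move=> /cvgrPdist_lt yP.
exists y => e e0.
have [d [[Dd xd] yd]] := filter_ex (filterI (near_x e e0) (yP e e0)).
by exists d, (phi d); split=> //; exact: phiP.
Qed.

Let clG_le x y : clG x y -> `|y| <= C * `|x|.
Proof.
move=> xy; apply: (@le_mul_eps (C + 1)); first by rewrite addr_ge0.
move=> e e0; have [a [b [Gab xa yb]]] := xy e e0.
rewrite -[y](subrK b); apply: le_trans (ler_normD _ _) _.
rewrite mulrDl mul1r addrA [leLHS]addrC; apply: lerD; last exact: ltW.
apply: le_trans (GC Gab) _; rewrite -mulrDr ler_wpM2l//.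
rewrite -[a](subrK x) [leRHS]addrC; apply: le_trans (ler_normD _ _) _.
by rewrite lerD2r distrC ltW.
Qed.

Let clG_linear : linear_graph clG.
Proof.
move=> k x y x' y' xx yy e e0.
pose r := e / (`|k| + 1).
have k1 : 0 < `|k| + 1 by rewrite ltr_wpDl.
have r0 : 0 < r by exact: divr_gt0.
have [a [a' [Ga xa xa']]] := xx r r0; have [b [b' [Gb yb yb']]] := yy r r0.
have small (U : normedModType K) (u v : U) :
    `|u| < r -> `|v| < r -> `|k *: u + v| < e.
  move=> ur vr; apply: le_lt_trans (ler_normD _ _) _.
  rewrite normrZ -[ltRHS](divfK (lt0r_neq0 k1)) mulrDr mulr1 mulrC.
  by rewrite ler_ltD// ler_wpM2r// ltW.
exists (k *: a + b), (k *: a' + b'); split; first exact: GL.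
  rewrite opprD addrACA -scalerBr; exact: small.
rewrite opprD addrACA -scalerBr; exact: small.
Qed.

(** A bounded linear map on a dense subspace extends to the whole space: the
    closure of its graph is again a graph, defined everywhere by completeness of
    the target, and obeys the same bound. *)
Lemma dense_graph_extension : exists F : V -> W,
  [/\ linear F, forall x, `|F x| <= C * `|x| & forall x y, G x y -> F x = y].
Proof.
have [F clF] := choice clG_ex.
have F_eq x y : clG x y -> F x = y.
  move=> xy; apply/eqP; rewrite -subr_eq0 -normr_le0.
  have := clG_le (clG_linear (-1) xy (clF x)).
  by rewrite !scaleN1r [- y + _]addrC addNr normr0 mulr0.
exists F; split=> [k x y|x|x y Gxy].
- exact/F_eq/clG_linear.
- exact: clG_le.
- by apply: F_eq => e e0; exists x, y; rewrite !subrr !normr0.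
Qed.

End Graph.
End DenseExtension.

(** * The C*-algebra of bounded adjointable operators *)

Lemma ge0_complex (R : realType) (z : R[i]) :
  0 <= z -> exists2 r : R, 0 <= r & z = r%:C%C.
Proof. by case: z => a b; rewrite lecE /= => /andP[/eqP -> a0]; exists a. Qed.

Section BoundedOperators.
Variables (R : realType) (H : hilbertType R).

(** Carrying the adjoint as a field makes the involution a mere exchange of the
    two maps. Linearity follows from the adjoint identity and the adjoint is
    determined by the operator, so two operators with equal values are equal. *)
Record bounded_operator : Type := BoundedOperator {
  op_fun :> H -> H;
  op_adj : H -> H;
  op_adjP : forall x y, inner (op_fun x) y = inner x (op_adj y);
  op_bounded : exists2 C : R[i], 0 <= C & forall x, `|op_fun x| <= C * `|x|
}.

Implicit Types (f g : bounded_operator) (x y : H).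

Lemma op_ext f g : f =1 g -> f = g.
Proof.
case: f g => [f f' ff' f1] [g g' gg' g1] /= /funext fg; subst g.
have fg' : f' = g'.
  apply/funext => y; apply: inner_extl => z.
  by rewrite innerC -ff' gg' -innerC.
by subst g'; rewrite (Prop_irrelevance gg' ff') (Prop_irrelevance g1 f1).
Qed.

Lemma op_linear f : linear f.
Proof.
move=> k x y; apply: inner_extl => z.
by rewrite op_adjP !innerDl !innerZl !op_adjP.
Qed.

Lemma op_adjC f x y : inner (op_adj f x) y = inner x (f y).
Proof. by rewrite innerC -op_adjP -innerC. Qed.

Lemma op_adj_bound f (C : R[i]) :
  0 <= C -> (forall x, `|f x| <= C * `|x|) ->
  forall x, `|op_adj f x| <= C * `|x|.
Proof.
move=> C0 fC x; apply: norm_le_dual; first exact: mulr_ge0.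
move=> y; rewrite -op_adjP mulrAC.
apply: le_trans (cauchy_schwarz _ _) _.
by rewrite ler_wpM2r.
Qed.

Lemma op_adj_bounded f :
  exists2 C : R[i], 0 <= C & forall x, `|op_adj f x| <= C * `|x|.
Proof.
by have [C C0 fC] := op_bounded f; exists C => //; exact: op_adj_bound.
Qed.

Definition op_star f := BoundedOperator (op_adjC f) (op_adj_bounded f).

Lemma op_zero_adjP (x y : H) : inner (0 : H) y = inner x 0.
Proof. by rewrite inner0l inner0r. Qed.

Lemma op_zero_bounded :
  exists2 C : R[i], 0 <= C & forall x : H, `|0 : H| <= C * `|x|.
Proof. by exists 0 => // x; rewrite normr0 mul0r. Qed.

Definition op_zero :=
  @BoundedOperator (fun=> 0) (fun=> 0) op_zero_adjP op_zero_bounded.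

Lemma op_one_bounded :
  exists2 C : R[i], 0 <= C & forall x : H, `|x| <= C * `|x|.
Proof. by exists 1 => // x; rewrite mul1r. Qed.

Definition op_one := @BoundedOperator id id (fun _ _ => erefl) op_one_bounded.

Lemma op_add_adjP f g x y :
  inner (f x + g x) y = inner x (op_adj f y + op_adj g y).
Proof. by rewrite innerDl innerDr !op_adjP. Qed.

Lemma op_add_bounded f g :
  exists2 C : R[i], 0 <= C & forall x, `|f x + g x| <= C * `|x|.
Proof.
have [C C0 fC] := op_bounded f; have [D D0 gD] := op_bounded g.
exists (C + D); first exact: addr_ge0.
by move=> x; rewrite mulrDl; apply: le_trans (ler_normD _ _) (lerD _ _).
Qed.

Definition op_add f g := BoundedOperator (op_add_adjP f g) (op_add_bounded f g).

Lemma op_scale_adjP (k : R[i]) f x y :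
  inner (k *: f x) y = inner x (Num.conj k *: op_adj f y).
Proof. by rewrite innerZl innerZr conjCK op_adjP. Qed.

Lemma op_scale_bounded (k : R[i]) f :
  exists2 C : R[i], 0 <= C & forall x, `|k *: f x| <= C * `|x|.
Proof.
have [C C0 fC] := op_bounded f; exists (`|k| * C); first exact: mulr_ge0.
by move=> x; rewrite normrZ -mulrA ler_wpM2l.
Qed.

Definition op_scale k f :=
  BoundedOperator (op_scale_adjP k f) (op_scale_bounded k f).

Lemma op_comp_adjP f g x y :
  inner (f (g x)) y = inner x (op_adj g (op_adj f y)).
Proof. by rewrite !op_adjP. Qed.

Lemma op_comp_bounded f g :
  exists2 C : R[i], 0 <= C & forall x, `|f (g x)| <= C * `|x|.
Proof.
have [C C0 fC] := op_bounded f; have [D D0 gD] := op_bounded g.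
exists (C * D); first exact: mulr_ge0.
by move=> x; apply: le_trans (fC _) _; rewrite -mulrA ler_wpM2l.
Qed.

Definition op_comp f g :=
  BoundedOperator (op_comp_adjP f g) (op_comp_bounded f g).

HB.instance Definition _ := gen_eqMixin bounded_operator.
HB.instance Definition _ := gen_choiceMixin bounded_operator.

Let addA : associative op_add.
Proof. by move=> f g h; apply: op_ext => x /=; rewrite addrA. Qed.

Let addC : commutative op_add.
Proof. by move=> f g; apply: op_ext => x /=; rewrite addrC. Qed.

Let add0 : left_id op_zero op_add.
Proof. by move=> f; apply: op_ext => x /=; rewrite add0r. Qed.

Let addN : left_inverse op_zero (op_scale (-1)) op_add.
Proof. by move=> f; apply: op_ext => x /=; rewrite scaleN1r addNr. Qed.

HB.instance Definition _ :=
  GRing.isZmodule.Build bounded_operator addA addC add0 addN.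

Let scaleA (a b : R[i]) f : op_scale a (op_scale b f) = op_scale (a * b) f.
Proof. by apply: op_ext => x /=; rewrite scalerA. Qed.

Let scale1 : left_id 1 op_scale.
Proof. by move=> f; apply: op_ext => x /=; rewrite scale1r. Qed.

Let scaleDr : right_distributive op_scale +%R.
Proof. by move=> a f g; apply: op_ext => x /=; rewrite scalerDr. Qed.

Let scaleDl f : {morph op_scale^~ f : a b / a + b}.
Proof. by move=> a b; apply: op_ext => x /=; rewrite scalerDl. Qed.

HB.instance Definition _ := GRing.Zmodule_isLmodule.Build R[i] bounded_operator
  scaleA scale1 scaleDr scaleDl.

Lemma opDE f g x : (f + g) x = f x + g x. Proof. by []. Qed.

Lemma opBE f g x : (f - g) x = f x - g x.
Proof. by rewrite opDE; congr (_ + _); exact: scaleN1r. Qed.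

Lemma opZE (k : R[i]) f x : (k *: f) x = k *: f x. Proof. by []. Qed.

(** The least bound is taken in the reals because norms have values in the
    complex numbers, where infima make no sense. *)
Definition op_norm f : R[i] :=
  (inf [set r : R | 0 <= r /\ forall x, `|f x| <= r%:C%C * `|x|])%:C%C.

Let bounds f := [set r : R | 0 <= r /\ forall x, `|f x| <= r%:C%C * `|x|].

Let bounds_lb f : has_lbound (bounds f).
Proof. by exists 0 => r []. Qed.

Let bounds_neq0 f : bounds f !=set0.
Proof.
have [C /ge0_complex[r r0 ->] fC] := op_bounded f; by exists r.
Qed.

Lemma op_norm_ge0 f : 0 <= op_norm f.
Proof. by rewrite ler0c; apply: lb_le_inf => [|r []//]; exact: bounds_neq0. Qed.

Lemma op_norm_le f (C : R[i]) :
  0 <= C -> (forall x, `|f x| <= C * `|x|) -> op_norm f <= C.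
Proof.
move=> /ge0_complex[r r0 ->] fr; rewrite lecR; apply: ge_inf => //.
exact: bounds_lb.
Qed.

Lemma le_op_norm f x : `|f x| <= op_norm f * `|x|.
Proof.
have [->|x0] := eqVneq x 0.
  have -> : f 0 = 0 by have := op_linear f (-1) 0 0; rewrite !scaleN1r !addNr.
  by rewrite !normr0 mulr0.
have xgt0 : 0 < `|x| by rewrite normr_gt0.
rewrite -ler_pdivrMr//.
have /ge0_complex[r r0 rE] : 0 <= `|f x| / `|x| by rewrite divr_ge0.
rewrite rE lecR; apply: lb_le_inf; first exact: bounds_neq0.
by move=> s [s0 fs]; rewrite -lecR -rE ler_pdivrMr.
Qed.

Let op_normD f g : op_norm (f + g) <= op_norm f + op_norm g.
Proof.
apply: op_norm_le => [|x]; first by rewrite addr_ge0 ?op_norm_ge0.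
by rewrite mulrDl; apply: le_trans (ler_normD _ _) (lerD _ _); exact: le_op_norm.
Qed.

Let op_normZ (k : R[i]) f : op_norm (k *: f) = `|k| * op_norm f.
Proof.
have le (l : R[i]) g : op_norm (l *: g) <= `|l| * op_norm g.
  apply: op_norm_le => [|x]; first by rewrite mulr_ge0 ?op_norm_ge0.
  by rewrite opZE normrZ -mulrA ler_wpM2l ?le_op_norm.
apply/eqP; rewrite eq_le le /=; have [->|k0] := eqVneq k 0.
  by rewrite normr0 mul0r op_norm_ge0.
rewrite -ler_pdivlMl ?normr_gt0// -normfV.
by apply: le_trans (le _ _); rewrite scalerA mulVf// scale1r.
Qed.

Let op_norm0_eq0 f : op_norm f = 0 -> f = 0.
Proof.
move=> f0; apply: op_ext => x; apply/eqP; rewrite -normr_le0.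
by have := le_op_norm f x; rewrite f0 mul0r.
Qed.

HB.instance Definition _ := Lmodule_isNormed.Build R[i] bounded_operator
  op_normD op_normZ op_norm0_eq0.

Lemma op_le f x : `|f x| <= `|f| * `|x|.
Proof. exact: le_op_norm. Qed.

Lemma norm_op_le f (C : R[i]) :
  0 <= C -> (forall x, `|f x| <= C * `|x|) -> `|f| <= C.
Proof. exact: op_norm_le. Qed.

Lemma op_adjB f g x : op_adj (f - g) x = op_adj f x - op_adj g x.
Proof.
by apply: inner_extl => y; rewrite op_adjC opBE innerBr innerBl !op_adjC.
Qed.

Lemma op_adj_le f x : `|op_adj f x| <= `|f| * `|x|.
Proof. by apply: op_adj_bound => // y; exact: op_le. Qed.

(** Shared by the operators and by their adjoints, whose differences are both
    controlled by the operator norm. *)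
Let cauchy_pointwise (F : set_system bounded_operator)
    (ev : bounded_operator -> H -> H) :
    (forall f g x, `|ev f x - ev g x| <= `|f - g| * `|x|) ->
    ProperFilter F -> cauchy F ->
  exists g : H -> H, forall x, ev^~ x @ F --> g x.
Proof.
move=> evB FF /cauchyP Fc.
suff /choice[g gP] : forall x, exists y, ev^~ x @ F --> y by exists g.
move=> x.
have FFx : ProperFilter (ev^~ x @ F) by exact: fmap_proper_filter.
exists (lim (ev^~ x @ F)); apply: (cauchy_cvg (ev^~ x @ F)).
apply: cauchy_exP => e e0.
have x1 : 0 < `|x| + 1 by rewrite ltr_wpDl.
have [f Ff] := Fc (e / (`|x| + 1)) (divr_gt0 e0 x1).
exists (ev f x); rewrite -ball_normE.
suff : F [set g | `|ev f x - ev g x| < e] by [].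
apply: filterS Ff => g; rewrite -ball_normE /= => fg.
apply: le_lt_trans (evB _ _ _) _.
apply: le_lt_trans (_ : e / (`|x| + 1) * `|x| < e).
  by rewrite ler_wpM2r// ltW.
by rewrite mulrAC ltr_pdivrMr// ltr_pM2l// ltrDl.
Qed.

(** A Cauchy filter of operators converges pointwise, together with its adjoints.
    The adjoint identity passes to the limit, and the Cauchy estimates hold
    uniformly on the unit ball, so the convergence is in norm. *)
Lemma op_complete (F : set_system bounded_operator) :
  ProperFilter F -> cauchy F -> cvg F.
Proof.
move=> FF Fc.
have [g gF] : exists g : H -> H, forall x, (fun f => f x) @ F --> g x.
  apply: (@cauchy_pointwise F op_fun) => // f1 f2 x.
  by rewrite -opBE; exact: op_le.
have [h hF] : exists h : H -> H, forall x, op_adj^~ x @ F --> h x.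
  apply: (@cauchy_pointwise F op_adj) => // f1 f2 x.
  by rewrite -op_adjB; exact: op_adj_le.
have gh x y : inner (g x) y = inner x (h y).
  apply/eqP; rewrite -subr_eq0 -normr_le0.
  apply: (@le_mul_eps _ (`|y| + `|x|)); first by rewrite addr_ge0.
  move=> e e0; rewrite add0r.
  have /cvgrPdist_le/(_ e e0) gx := gF x.
  have /cvgrPdist_le/(_ e e0) hy := hF y.
  have [f [gxf hyf]] := filter_ex (filterI gx hy).
  have -> : inner (g x) y - inner x (h y) =
      inner (g x - f x) y - inner x (h y - op_adj f y).
    by rewrite innerBl innerBr op_adjP opprB addrA subrK.
  apply: le_trans (ler_normB _ _) _; rewrite mulrDl; apply: lerD.
    by apply: le_trans (cauchy_schwarz _ _) _; rewrite mulrC ler_wpM2l.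
  by apply: le_trans (cauchy_schwarz _ _) _; rewrite ler_wpM2l.
have g_near f r : 0 <= r -> F (ball f r) -> forall x, `|g x - f x| <= r * `|x|.
  move=> r0 Ff x; apply: (@le_mul_eps _ 1) => // e e0; rewrite mul1r.
  have /cvgrPdist_le/(_ e e0) gx := gF x.
  have [f' [ff' gxf']] := filter_ex (filterI Ff gx).
  rewrite -(subrKA (f' x)) addrC; apply: le_trans (ler_normD _ _) _.
  apply: lerD => //; rewrite -opBE; apply: le_trans (op_le _ _) _.
  by rewrite ler_wpM2r// distrC ltW//; move: ff'; rewrite -ball_normE.
have g_bounded : exists2 C : R[i], 0 <= C & forall x, `|g x| <= C * `|x|.
  have [f Ff] := (cauchyP F).1 Fc 1 ltr01.
  exists (1 + `|f|); first by rewrite addr_ge0.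
  move=> x; rewrite -[g x](subrK (f x)); apply: le_trans (ler_normD _ _) _.
  by rewrite mulrDl lerD ?g_near ?op_le.
apply: (@cvgP _ _ (BoundedOperator gh g_bounded)).
apply/cvgrPdist_le => e e0.
have e20 : 0 < e / 2 by rewrite divr_gt0.
have [f Ff] := (cauchyP F).1 Fc (e / 2) e20.
apply: filterS (Ff) => f' ff'; apply: norm_op_le => [|x]; first exact: ltW.
rewrite opBE /= -(subrKA (f x)); apply: le_trans (ler_normD _ _) _.
rewrite [e]splitr mulrDl; apply: lerD; first by apply: g_near => //; exact: ltW.
rewrite -opBE; apply: le_trans (op_le _ _) _.
by rewrite ler_wpM2r// ltW//; move: ff'; rewrite -ball_normE.
Qed.

HB.instance Definition _ :=
  Uniform_isComplete.Build bounded_operator op_complete.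

Let norm_star f : `|op_star f| <= `|f|.
Proof. by apply: norm_op_le => // x; exact: op_adj_le. Qed.

Let comp_norm f g : `|op_comp f g| <= `|f| * `|g|.
Proof.
apply: norm_op_le => [|x]; first exact: mulr_ge0.
by apply: le_trans (op_le f (g x)) _; rewrite -mulrA ler_wpM2l ?op_le.
Qed.

(** The nontrivial inequality comes from |f x|^2 = <f^* f x, x>, which gives
    |f| <= sqrt |f^* f|. *)
Let cstar_id f : `|op_comp (op_star f) f| = `|f| ^+ 2.
Proof.
apply/le_anti/andP; split.
  by apply: le_trans (comp_norm _ _) _; rewrite expr2 ler_wpM2r ?norm_star.
rewrite -[leRHS]sqrtCK ler_pXn2r ?nnegrE ?sqrtC_ge0//.
apply: norm_op_le => [|x]; first by rewrite sqrtC_ge0.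
rewrite -(@ler_pXn2r _ 2) ?nnegrE ?mulr_ge0 ?sqrtC_ge0//.
rewrite exprMn sqrtCK norm_inner op_adjP.
rewrite -[leLHS]ger0_norm; last by rewrite -op_adjP -norm_inner exprn_ge0.
apply: le_trans (cauchy_schwarz _ _) _; rewrite mulrC expr2 mulrA ler_wpM2r//.
exact: (op_le (op_comp (op_star f) f)).
Qed.

Let compA : associative op_comp.
Proof. by move=> f g h; apply: op_ext. Qed.

Let comp1l : left_id op_one op_comp.
Proof. by move=> f; apply: op_ext. Qed.

Let comp1r : right_id op_one op_comp.
Proof. by move=> f; apply: op_ext. Qed.

Let compDl : left_distributive op_comp +%R.
Proof. by move=> f g h; apply: op_ext. Qed.

Lemma opfD f x y : f (x + y) = f x + f y.
Proof. by apply: inner_extl => z; rewrite op_adjP !innerDl !op_adjP. Qed.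

Lemma opfZ f (k : R[i]) x : f (k *: x) = k *: f x.
Proof. by apply: inner_extl => z; rewrite op_adjP !innerZl op_adjP. Qed.

Let compDr : right_distributive op_comp +%R.
Proof. by move=> f g h; apply: op_ext => x; exact: opfD. Qed.

Let compZl (k : R[i]) f g : op_comp (k *: f) g = k *: op_comp f g.
Proof. exact: op_ext. Qed.

Let compZr (k : R[i]) f g : op_comp f (k *: g) = k *: op_comp f g.
Proof. by apply: op_ext => x; exact: opfZ. Qed.

Let starD f g : op_star (f + g) = op_star f + op_star g.
Proof. exact: op_ext. Qed.

Let starZ (k : R[i]) f : op_star (k *: f) = Num.conj k *: op_star f.
Proof. exact: op_ext. Qed.

Let starM f g : op_star (op_comp f g) = op_comp (op_star g) (op_star f).
Proof. exact: op_ext. Qed.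

Let starK : involutive op_star.
Proof. by move=> f; apply: op_ext. Qed.

HB.instance Definition _ := isCStarAlgebra.Build R bounded_operator
  compA comp1l comp1r compDl compDr compZl compZr starD starZ starM starK
  comp_norm cstar_id.

End BoundedOperators.

(** * Operators prescribed on a family with dense span *)

Section Linear.
Variables (K : pzRingType) (U V : lmodType K) (f : U -> V).
Hypothesis lf : linear f.

Lemma linear_fun0 : f 0 = 0.
Proof. by have := lf (-1) 0 0; rewrite !scaleN1r !addNr. Qed.

Lemma linear_funZ k x : f (k *: x) = k *: f x.
Proof. by have := lf k x 0; rewrite linear_fun0 !addr0. Qed.

Lemma linear_funD x y : f (x + y) = f x + f y.
Proof. by have := lf 1 x y; rewrite !scale1r. Qed.

Lemma linear_funB x y : f (x - y) = f x - f y.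
Proof. by rewrite linear_funD -scaleN1r linear_funZ scaleN1r. Qed.

Lemma linear_fun_sum I (r : seq I) (F : I -> U) :
  f (\sum_(k <- r) F k) = \sum_(k <- r) f (F k).
Proof.
by elim/big_rec2: _ => [|k x y _ <-]; rewrite ?linear_fun0 ?linear_funD.
Qed.

End Linear.

Definition family_span (K : pzRingType) (V : lmodType K) (I : Type) (f : I -> V)
    : set V :=
  [set x | exists s : seq (K * I), x = \sum_(p <- s) p.1 *: f p.2].

Section Gram.
Variables (R : realType) (H : hilbertType R) (I : Type) (f : I -> H).
Hypothesis f_dense : dense (family_span f).

(** The squared norm of a linear combination is determined by the Gram matrix, so
    the assignment f i |-> g i is well defined and isometric on the span. *)
Lemma gram_isometry (K : hilbertType R) (g : I -> K) :
    (forall i j, inner (g i) (g j) = inner (f i) (f j)) ->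
  exists V : H -> K,
    [/\ linear V, forall x, `|V x| <= `|x| & forall i, V (f i) = g i].
Proof.
move=> gram.
pose G x y := exists s : seq (R[i] * I),
  x = \sum_(p <- s) p.1 *: f p.2 /\ y = \sum_(p <- s) p.1 *: g p.2.
have GL : linear_graph G.
  move=> k _ _ _ _ [s [-> ->]] [t [-> ->]].
  exists ([seq (k * p.1, p.2) | p <- s] ++ t).
  rewrite !big_cat !big_map !scaler_sumr.
  by split; congr (_ + _); apply: eq_bigr => p _; rewrite scalerA.
have GC x y : G x y -> `|y| <= 1 * `|x|.
  move=> [s [-> ->]]; rewrite mul1r -(@ler_pXn2r _ 2) ?nnegrE// !norm_inner.
  rewrite !inner_suml le_eqVlt; apply/orP; left; apply/eqP.
  apply: eq_bigr => p _; rewrite !innerZl; congr (_ * _).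
  rewrite innerC [RHS]innerC !inner_suml; congr (Num.conj _).
  by apply: eq_bigr => q _; rewrite !innerZl gram.
have Gd : dense [set x | exists y, G x y].
  apply/denseP => x e e0; have /denseP/(_ x e e0)[_ [s ->] xd] := f_dense.
  exists (\sum_(p <- s) p.1 *: f p.2) => //.
  by exists (\sum_(p <- s) p.1 *: g p.2), s.
have [V [lV VC VG]] := dense_graph_extension ler01 GL GC Gd.
exists V; split=> // [x|j]; first by have := VC x; rewrite mul1r.
apply: VG; exists [:: (1, j)]; by rewrite !big_seq1 !scale1r.
Qed.

(** The vectors y for which some z satisfies <V x, y> = <x, z> for all x form a
    subspace on which y |-> z is linear and contractive. It contains the span of
    f by the second hypothesis, so it is dense and the adjoint extends to H. *)
Lemma gram_operator (g b : I -> H) :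
    (forall i j, inner (g i) (g j) = inner (f i) (f j)) ->
    (forall i j, inner (g i) (f j) = inner (f i) (b j)) ->
  exists V : bounded_operator H,
    (forall i, V (f i) = g i) /\ (forall i, op_adj V (f i) = b i).
Proof.
move=> /gram_isometry[V [lV VC Vf]] gb.
have adj i x : inner (V x) (f i) = inner x (b i).
  apply/eqP; rewrite -subr_eq0; apply/eqP; move: x.
  apply: (@dense_vanish _ _ R[i] _ _ (`|f i| + `|b i|)) f_dense _.
  - by rewrite addr_ge0.
  - move=> x y; rewrite (linear_funB lV) !innerBl !opprB [LHS]addrACA.
    by rewrite [RHS]addrACA [- _ + _ in RHS]addrC.
  - move=> x; apply: le_trans (ler_normB _ _) _; rewrite mulrDl; apply: lerD.
      apply: le_trans (cauchy_schwarz _ _) _; by rewrite mulrC ler_wpM2l.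
    by rewrite mulrC; exact: cauchy_schwarz.
  - move=> _ [s ->]; rewrite (linear_fun_sum lV) !inner_suml -sumrB big1// => p _.
    by rewrite (linear_funZ lV) !innerZl Vf gb subrr.
pose G y z := forall x, inner (V x) y = inner x z.
have GL : linear_graph G.
  by move=> k y z y' z' yy zz x; rewrite !innerDr !innerZr yy zz.
have GC y z : G y z -> `|z| <= 1 * `|y|.
  move=> yz; apply: norm_le_dual => [|x]; first by rewrite mul1r.
  rewrite -yz mul1r mulrC; apply: le_trans (cauchy_schwarz _ _) _.
  by rewrite ler_wpM2r.
have Gd : dense [set y | exists z, G y z].
  apply/denseP => x e e0; have /denseP/(_ x e e0)[_ [s ->] xd] := f_dense.
  exists (\sum_(p <- s) p.1 *: f p.2) => //.
  exists (\sum_(p <- s) p.1 *: b p.2) => y.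
  rewrite innerC [RHS]innerC !inner_suml; congr (Num.conj _).
  apply: eq_bigr => p _; rewrite !innerZl; congr (_ * _).
  by rewrite innerC adj -innerC.
have [F [lF FC FG]] := dense_graph_extension ler01 GL GC Gd.
have VF x y : inner (V x) y = inner x (F y).
  apply/eqP; rewrite -subr_eq0; apply/eqP; move: y.
  apply: (@dense_vanish _ _ R[i] _ _ (`|V x| + `|x|)) Gd _.
  - by rewrite addr_ge0.
  - move=> y z; rewrite (linear_funB lF) !innerBr !opprB [LHS]addrACA.
    by rewrite [RHS]addrACA [- _ + _ in RHS]addrC.
  - move=> y; apply: le_trans (ler_normB _ _) _; rewrite mulrDl; apply: lerD.
      exact: cauchy_schwarz.
    apply: le_trans (cauchy_schwarz _ _) _; rewrite ler_wpM2l//.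
    by have := FC y; rewrite mul1r.
  - by move=> y [z yz]; rewrite (FG y z yz) yz subrr.
have VB : exists2 C : R[i], 0 <= C & forall x, `|V x| <= C * `|x|.
  by exists 1 => // x; rewrite mul1r.
exists (BoundedOperator VF VB); split=> // i /=.
by apply: FG => x; exact: adj.
Qed.

End Gram.

Lemma linear_span_ext (R : realType) (H : hilbertType R) (I : Type)
    (f : I -> H) (V W : H -> H) :
    dense (family_span f) -> linear V -> linear W ->
  continuous V -> continuous W -> (forall i, V (f i) = W (f i)) -> V = W.
Proof.
move=> f_dense lV lW cV cW VW; apply: dense_continuous_ext f_dense _ => //.
move=> _ [s ->]; rewrite !linear_fun_sum//; apply: eq_bigr => p _.
by rewrite !linear_funZ ?VW.
Qed.

Lemma op_continuous (R : realType) (H : hilbertType R) (V : bounded_operator H) :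
  continuous V.
Proof.
apply: (@bounded_continuous _ _ _ V `|V|) => //; last exact: op_le.
exact/linear_funB/op_linear.
Qed.

Lemma op_eq_dense (R : realType) (H : hilbertType R) (I : Type) (f : I -> H)
    (V W : bounded_operator H) :
  dense (family_span f) -> (forall i, V (f i) = W (f i)) -> V = W.
Proof.
move=> f_dense VW; apply: op_ext => x.
by rewrite (linear_span_ext f_dense (op_linear V) (op_linear W)
  (@op_continuous _ _ V) (@op_continuous _ _ W) VW).
Qed.

(** * Continuity of GNS representations *)

Lemma bernoulli (K : numDomainType) (d : K) n :
  0 <= d -> 1 + d *+ n <= (1 + d) ^+ n.
Proof.
move=> d0; elim: n => [|n IH]; first by rewrite mulr0n addr0 expr0.
rewrite exprS; apply: (@le_trans _ _ ((1 + d) * (1 + d *+ n))).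
  rewrite mulrDl mul1r mulrDr mulr1 mulrS !addrA [1 + d + _]addrAC lerDl.
  by rewrite mulr_ge0// mulrn_wge0.
by rewrite ler_wpM2l// addr_ge0// ler01.
Qed.

(** Log-convexity says that the ratios u (n+1) / u n increase. If the first ratio
    exceeded M, then u would grow at least like a geometric sequence of ratio
    larger than M, against the bound u n <= M^n K. *)
Lemma logconvex_growth (R : realType) (u : nat -> R[i]) (M K : R[i]) :
    (forall n, 0 <= u n) -> 0 <= M ->
    (forall n, u n.+1 ^+ 2 <= u n.+2 * u n) ->
    (forall n, u n <= M ^+ n * K) ->
  u 1%N <= M * u 0%N.
Proof.
move=> u0 M0 uconv uK.
rewrite real_leNgt ?ger0_real ?mulr_ge0//; apply/negP => Mu.
have u1 : 0 < u 1%N by apply: le_lt_trans Mu; rewrite mulr_ge0.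
have u00 : 0 < u 0%N.
  rewrite lt_neqAle u0 andbT eq_sym; apply/eqP => u00.
  have := uconv 0%N; rewrite u00 mulr0 => /(lt_le_trans (exprn_gt0 2 u1)).
  by rewrite ltxx.
pose r := u 1%N / u 0%N.
have Mr : M < r by rewrite ltr_pdivlMr.
have r0 : 0 < r by exact: divr_gt0.
have ur n : 0 < u n /\ r * u n <= u n.+1.
  elim: n => [|n [un0 run]]; first by rewrite /r divfK ?gt_eqF.
  have un1 : 0 < u n.+1 by apply: lt_le_trans run; exact: mulr_gt0.
  split=> //; rewrite -(ler_pM2r un0); apply: le_trans (uconv n).
  by rewrite mulrAC expr2 ler_wpM2r// ltW.
have urn n : r ^+ n * u 0%N <= u n.
  elim: n => [|n IH]; first by rewrite expr0 mul1r.
  apply: le_trans (ur n).2; rewrite exprS -mulrA ler_wpM2l//; exact: ltW.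
have M_gt0 : 0 < M.
  rewrite lt_neqAle M0 andbT eq_sym; apply/eqP => M00.
  have := le_trans (urn 1%N) (uK 1%N); rewrite M00 expr0n mul0r expr1.
  by move=> /(lt_le_trans (mulr_gt0 r0 u00)); rewrite ltxx.
pose d := r / M - 1.
have d0 : 0 < d by rewrite subr_gt0 ltr_pdivlMr// mul1r.
have dn n : d *+ n <= K / u 0%N.
  apply: le_trans (_ : (1 + d) ^+ n <= _).
    by apply: le_trans (bernoulli n (ltW d0)); rewrite lerDr ler01.
  rewrite /d addrC subrK expr_div_n ler_pdivlMr// mulrAC ler_pdivrMr ?exprn_gt0//.
  by rewrite [K * _]mulrC; apply: le_trans (urn n) (uK n).
have [x x0 xE] : exists2 x : R, 0 <= x & K / u 0%N / d = x%:C%C.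
  by apply: ge0_complex; rewrite divr_ge0 ?(ltW d0)//; have := dn 0%N.
have := dn (Num.Def.archi_bound x).
rewrite -mulr_natl -ler_pdivlMr// xE.
have -> : (Num.Def.archi_bound x)%:R = ((Num.Def.archi_bound x)%:R)%:C%C :> R[i].
  by rewrite rmorph_nat.
by rewrite lecR leNgt archi_boundP.
Qed.

Section GNS.
Variables (R : realType) (B : cstarAlgType R).

Lemma norm_cstar (b : B) : `|star b| = `|b|.
Proof.
have le (a : B) : `|a| <= `|star a|.
  have [->|a0] := eqVneq a 0; first by rewrite normr0.
  have := cstar_normM (star a) a.
  by rewrite cstar_identity expr2 ler_pM2r// normr_gt0.
by apply/le_anti; rewrite le -{2}(starK b) le.
Qed.

Variables (H : hilbertType R) (pi : B -> H -> H).
Hypothesis pi_rep : is_representation pi.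

Lemma repM a b h : pi (a *c b) h = pi a (pi b h). Proof. by case: pi_rep. Qed.

Lemma rep_adj a h k : inner (pi a h) k = inner h (pi (star a) k).
Proof. by case: pi_rep. Qed.

Lemma rep_norm2 a h : `|pi a h| ^+ 2 = inner (pi (star a *c a) h) h.
Proof. by rewrite norm_inner repM [RHS]rep_adj starK. Qed.

Variables (rho : B -> R[i]) (rho_state : is_state rho) (xi : H).
Hypothesis gns : is_gns rho pi xi.

Lemma gns_norm_le a : `|pi a xi| <= `|a|.
Proof.
have [_ _ rhoE] := gns; have [_ _ rho_le _] := rho_state.
rewrite -(@ler_pXn2r _ 2) ?nnegrE// -cstar_identity.
by rewrite -[leLHS]ger0_norm ?exprn_ge0// rep_norm2 rhoE.
Qed.

(** For c = b^* b the sequence |pi c^n (pi y xi)| is log-convex by Cauchy-Schwarz,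
    and it is at most |c|^n |y| because |pi a xi|^2 = rho (a^* a) <= |a|^2. The
    growth lemma bounds |pi c (pi y xi)| by |c| |pi y xi|, and
    |pi b h|^2 = <pi c h, h> transfers this to b without any functional calculus. *)
Let contractive_cyclic b y : `|pi b (pi y xi)| <= `|b| * `|pi y xi|.
Proof.
have k0 : 0 <= `|pi y xi| by [].
pose c := star b *c b; have cs : star c = c by rewrite /c starM starK.
have cle : `|pi c (pi y xi)| <= `|c| * `|pi y xi|.
  pose z n := iter n (fun a => c *c a) y.
  rewrite -repM.
  apply: (@logconvex_growth _ (fun n => `|pi (z n) xi|) _ `|y|) => //.
  - have zS m : pi (z m.+1) xi = pi c (pi (z m) xi) by rewrite -repM.
    move=> n; rewrite !zS; move: (pi (z n) xi) => v.
    rewrite -[leLHS]ger0_norm ?exprn_ge0// (rep_norm2 c v) cs repM.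
    exact: cauchy_schwarz.
  - move=> n; apply: le_trans (gns_norm_le _) _.
    elim: n => [|n IH]; first by rewrite expr0 mul1r.
    apply: le_trans (cstar_normM _ _) _.
    by rewrite exprS -mulrA ler_wpM2l.
rewrite -(@ler_pXn2r _ 2) ?nnegrE ?mulr_ge0// exprMn -cstar_identity.
rewrite rep_norm2 -[leLHS]ger0_norm; last by rewrite -rep_norm2 exprn_ge0.
apply: le_trans (cauchy_schwarz _ _) _.
by rewrite expr2 mulrA ler_wpM2r.
Qed.

(** Continuity of pi b is not part of the definition of a representation. On the
    dense orbit of xi it is the previous estimate applied to b^*; elsewhere it
    follows from <x, pi b h> = <pi b^* x, h> by approximating x. *)
Lemma gns_contractive b h : `|pi b h| <= `|b| * `|h|.
Proof.
apply: norm_le_dual => [|x]; first exact: mulr_ge0.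
have [_ pi_dense _] := gns.
apply: (@le_mul_eps _ (`|pi b h| + `|b| * `|h|)).
  by rewrite addr_ge0 ?mulr_ge0.
move=> e e0; have /denseP/(_ x e e0)[_ [y _ <-] xd] := pi_dense.
move: xd; set d := pi y xi => xd.
have dx : `|d| <= `|x| + e.
  rewrite -[d](subrK x) addrC; apply: le_trans (ler_normD _ _) _.
  by rewrite lerD2l distrC ltW.
rewrite -(subrK d x) innerDl; apply: le_trans (ler_normD _ _) _.
rewrite subrK mulrDl addrCA; apply: lerD.
  apply: le_trans (cauchy_schwarz _ _) _.
  by rewrite mulrC ler_wpM2l// ltW.
rewrite -mulrDr -(starK b) -rep_adj starK; apply: le_trans (cauchy_schwarz _ _) _.
rewrite mulrAC ler_wpM2r//; apply: le_trans (contractive_cyclic _ _) _.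
by rewrite norm_cstar ler_wpM2l.
Qed.

End GNS.

(** * Core factorisations *)

Section CoreMonoid.
Variable S : monoidType.
Hypothesis S_lcm : right_lcm_semigroup S.
Local Open Scope group_scope.

Lemma right_lcm_mulI (s x y : S) : s * x = s * y -> x = y.
Proof. by have [inj _] := S_lcm; exact: inj. Qed.

Lemma is_right_lcmP (P : monoidType) (r s t : P) :
  is_right_lcm r s t <->
  forall z, (exists x, z = r * x) <->
    (exists x, z = s * x) /\ (exists x, z = t * x).
Proof.
have E u z : principal_ideal u z <-> exists x, z = u * x :> P.
  by split=> [[x _ <-]|[x ->]]; exists x.
split=> [rst z|rst]; first by rewrite -!E -rst.
by apply/seteqP; split=> z /=; rewrite !E rst.
Qed.

Lemma coreP (a : S) : reflect (forall s, exists x y, a * x = s * y) (core a).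
Proof.
apply: (iffP (asboolP _)) => h s.
  by have [_ [[x _ <-] [y _ e]]] := h s; exists x, y.
by have [x [y e]] := h s; exists (a * x); split; [exists x|exists y].
Qed.

Lemma core_right_factor (a b : S) : core (a * b) -> core b.
Proof.
move=> /coreP ab; apply/coreP => s; have [x [y]] := ab (a * s).
by rewrite -!mulgA => /right_lcm_mulI e; exists x, y.
Qed.

(** A multiple of s z lies in t S because t is in the core; it is then a common
    multiple of s and t, hence a multiple of s a, and s cancels. *)
Lemma core_lcm_cofactor (s t a : S) :
  core t -> is_right_lcm (s * a) s t -> core a.
Proof.
move=> /coreP ct /is_right_lcmP st; apply/coreP => z.
have [x [y e]] := ct (s * z).
have [|u] := (st (s * z * y)).2.
  by split; [exists (z * y); rewrite mulgA | exists x].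
by rewrite -!mulgA => /right_lcm_mulI e'; exists u, y.
Qed.

(** Any two elements of the core have a right LCM in the core: a right LCM in S
    exists, its cofactors belong to the core, and so do the cofactors of a common
    multiple taken in the core. *)
Lemma core_right_lcm (x y : core_monoid S) :
  exists a b : core_monoid S, x * a = y * b /\ is_right_lcm (x * a) x y.
Proof.
have cx := core_valP x; have cy := core_valP y.
have [r xyr] : exists r, is_right_lcm r (core_val x) (core_val y).
  have [_ /(_ (val x) (val y))[|//]] := S_lcm.
  have [u [v e]] := elimT (coreP _) cx (val y).
  move=> /seteqP[/(_ (core_val x * u)) h _].
  by case: h; split; [exists u|exists v].
have /is_right_lcmP rP := xyr.
have [[a ra] [b rb]] := (rP r).1 (ex_intro _ 1 (esym (mulg1 r))).
have ca : core a.
  apply: (@core_lcm_cofactor (val x) _ _ cy); rewrite -ra; exact: xyr.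
have cb : core b.
  apply: (@core_lcm_cofactor (val y) _ _ cx); rewrite -rb; apply/is_right_lcmP => z.
  by rewrite rP; tauto.
have e : x * CoreMonoid ca = y * CoreMonoid cb by apply: val_inj; rewrite /= -ra.
exists (CoreMonoid ca), (CoreMonoid cb); split=> //.
apply/is_right_lcmP => z; split=> [[u ->]|[[u zu] [v zv]]].
  split; first by exists (CoreMonoid ca * u); rewrite mulgA.
  by exists (CoreMonoid cb * u); rewrite e mulgA.
have [|n zn] := (rP (val z)).2.
  by split; [exists (val u); rewrite zu|exists (val v); rewrite zv].
have cn : core n by apply: (@core_right_factor r); rewrite -zn; exact: core_valP.
by exists (CoreMonoid cn); apply: val_inj; rewrite /= zn ra.
Qed.

Variables (T : set S) (i : S -> T) (c : S -> core_monoid S).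
Hypothesis T_transversal : transversal_core_equiv T.
Hypothesis icP : forall s, s = (val (i s) * val (c s))%g.

(** If s = t a with a in the core, then s ~ t and s ~ i s, hence i s = t. *)
Lemma ic_unique (s : S) (t : T) (a : core_monoid S) :
  s = val t * val a -> i s = t /\ c s = a.
Proof.
have [_ T_inj] := T_transversal.
move=> sta; have it : i s = t.
  apply: val_inj; apply: T_inj; [exact: set_valP|exact: set_valP|].
  exists (val (c s)), (val a); split; [exact: core_valP|exact: core_valP|].
  by rewrite -icP.
split=> //; apply/val_inj/(@right_lcm_mulI (val t)).
by rewrite -sta -it -icP.
Qed.

Lemma ic_mul_core (s : S) (a : core_monoid S) :
  i (s * val a) = i s /\ c (s * val a) = c s * a.
Proof. by apply: ic_unique; rewrite /= mulgA -icP. Qed.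

Lemma ic_transversal (t : T) : i (val t) = t /\ c (val t) = 1.
Proof. by apply: ic_unique; rewrite mulg1. Qed.

(** The cocycle identity behind V (s r) = V s V r. *)
Lemma ic_mul (s r : S) :
  i (s * r) = i (s * val (i r)) /\ c (s * r) = c (s * val (i r)) * c r.
Proof. by rewrite {1 3}(icP r) mulgA; exact: ic_mul_core. Qed.

(** Elements with the same representative become equal after multiplication by
    elements of the core, and the multipliers can be chosen minimal. *)
Lemma i_mul_ore (s t q r : S) : i (s * q) = i (t * r) ->
  exists a b : core_monoid S,
    [/\ s * q * val a = t * r * val b, c (s * q) * a = c (t * r) * b
      & is_right_lcm (c (s * q) * a) (c (s * q)) (c (t * r))].
Proof.
move=> e; have [a [b [ab lab]]] := core_right_lcm (c (s * q)) (c (t * r)).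
exists a, b; split=> //.
rewrite (icP (s * q)) (icP (t * r)) e -!mulgA; congr (_ * _).
exact: (congr1 val ab).
Qed.

(** Makes V s isometric, and its adjoint well defined on the vectors e u z. *)
Lemma i_mul_inj (s : S) (t u : T) : i (s * val t) = i (s * val u) -> t = u.
Proof.
have [_ T_inj] := T_transversal.
move=> /i_mul_ore[a [b [e _ _]]]; apply: val_inj; apply: T_inj.
- exact: set_valP.
- exact: set_valP.
exists (val a), (val b); split; [exact: core_valP|exact: core_valP|].
by apply: (@right_lcm_mulI s); rewrite !mulgA.
Qed.

Lemma i_mul_orthogonal (s t q r : S) :
  ideal_orthogonal s t -> i (s * q) <> i (t * r).
Proof.
move=> /seteqP[st _] /i_mul_ore[a [b [e _ _]]]; apply: (st (s * q * val a)).
split; first by exists (q * val a) => //; rewrite mulgA.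
by exists (r * val b) => //; rewrite e mulgA.
Qed.

(** Let a, b in the core be minimal with s q a = t r b. This is a common multiple
    of s and t, so q a = s' m and r b = t' m for some m; take p = i m. Then
    c (s' p) divides a, with cofactor c m, so the common multiple
    c (sq) c (s' p) of c (sq) and c (tr) divides their right LCM c (sq) a. *)
Lemma i_mul_lcm (s t s' t' : S) (q r : T) :
    is_right_lcm (s * s') s t -> s * s' = t * t' ->
    i (s * val q) = i (t * val r) ->
  exists p : T, [/\ i (s' * val p) = q, i (t' * val p) = r,
    c (s * val q) * c (s' * val p) = c (t * val r) * c (t' * val p)
    & is_right_lcm (c (s * val q) * c (s' * val p))
        (c (s * val q)) (c (t * val r))].
Proof.
move=> /is_right_lcmP lst est /[dup] eqr /i_mul_ore[a [b [eab cab lab]]].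
have [|m em] := (lst (s * val q * val a)).2.
  by split; [exists (val q * val a)|exists (val r * val b)]; rewrite ?eab mulgA.
have qam : val q * val a = s' * m.
  by apply: (@right_lcm_mulI s); rewrite !mulgA.
have rbm : val r * val b = t' * m.
  by apply: (@right_lcm_mulI t); rewrite !mulgA -eab em est.
have [iq cq] : i (s' * m) = q /\ c (s' * m) = a by apply: ic_unique; rewrite -qam.
have [ir cr] : i (t' * m) = r /\ c (t' * m) = b by apply: ic_unique; rewrite -rbm.
have [iq' cq'] := ic_mul s' m; have [ir' cr'] := ic_mul t' m.
exists (i m); set p := i m in iq' cq' ir' cr' *.
have iq2 : i (s' * val p) = q by rewrite -iq'.
have ir2 : i (t' * val p) = r by rewrite -ir'.
have ecc : c (s * val q) * c (s' * val p) = c (t * val r) * c (t' * val p).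
  have [_] := ic_mul s (s' * val p); rewrite iq2 => <-.
  have [_] := ic_mul t (t' * val p); rewrite ir2 => <-.
  by rewrite !mulgA est.
split=> //.
have /is_right_lcmP labP := lab; apply/is_right_lcmP => z.
split=> [[u ->]|/labP[u ->]].
  split; first by exists (c (s' * val p) * u); rewrite mulgA.
  by exists (c (t' * val p) * u); rewrite ecc mulgA.
by exists (c m * u); rewrite -cq cq' !mulgA.
Qed.

End CoreMonoid.

(** * Truncation in direct sums of Hilbert modules *)

Lemma star_cone (R : realType) (B : cstarAlgType R) : star (@cone R B) = cone.
Proof. by rewrite -[RHS]starK -[star cone in RHS]cmul1l starM starK cmul1l. Qed.

Lemma star0 (R : realType) (B : cstarAlgType R) : star (0 : B) = 0.
Proof. by have := starZ 0 (0 : B); rewrite rmorph0 !scale0r. Qed.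

Lemma cmul0l (R : realType) (B : cstarAlgType R) (b : B) : 0 *c b = 0.
Proof. by have := cmulZl 0 (0 : B) b; rewrite !scale0r. Qed.

Section DirectSum.
Variables (R : realType) (B : cstarAlgType R) (T : choiceType).
Variables (M : hilbertModType B) (coord : M -> T -> standard_module B).
Hypothesis M_sum : is_direct_sum coord.
Variable xi : T -> M.
Hypothesis xiP : forall t u, coord (xi t) u = if u == t then cone else 0.

(** Only the term of index t contributes to the sum defining the inner product. *)
Lemma hinner_xi t x : hinner (xi t) x = coord x t.
Proof.
have [_ _ _ _ /(_ (xi t) x)] := M_sum; set F := partial_sum _.
have F_t : \forall E \near totally, F E = coord x t.
  exists [fset t]%fset => // E; rewrite /= fsub1set => tE.
  rewrite /F /partial_sum (bigD1 [` tE]%fset)//= big1 => [|u ut].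
    by rewrite addr0 xiP eqxx; rewrite -[LHS]/(star cone *c _) star_cone cmul1l.
  rewrite xiP ifF; first by rewrite -[LHS]/(star 0 *c _) star0 cmul0l.
  by apply: contra_neqF ut => /eqP ut; apply: val_inj.
have FF : ProperFilter (F @ totally).
  exact: (fmap_proper_filter _ (@totally_filter T)).
have tF := @totally_filter T.
have Ft : F @ totally --> (coord x t : B) by exact: cvg_near_cst.
by move=> Fl; exact: (@norm_cvg_unique _ _ (F @ totally) FF) Fl Ft.
Qed.

Lemma hinnerBr (x y z : M) : hinner z (x - y) = hinner z x - hinner z y :> B.
Proof. by rewrite hinnerDr -scaleN1r hinnerZr scaleN1r. Qed.

Lemma hinner0r (z : M) : hinner z 0 = 0 :> B.
Proof. by rewrite -(scale0r (0 : M)) hinnerZr scale0r. Qed.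

Lemma hinner_sumr I (r : seq I) (f : I -> M) (z : M) :
  hinner z (\sum_(k <- r) f k) = \sum_(k <- r) hinner z (f k) :> B.
Proof.
by elim/big_rec2: _ => [|k a b _ <-]; rewrite ?hinner0r ?hinnerDr.
Qed.

Definition truncation (x : M) (E : {fset T}) : M :=
  \sum_(u : E) hact (xi (val u)) (coord x (val u)).

Lemma coord_truncation x (E : {fset T}) (u : E) :
  coord (truncation x E) (val u) = coord x (val u).
Proof.
have [lc hc _ _ _] := M_sum.
rewrite /truncation (linear_fun_sum (lc _)) (bigD1 u)//= big1 => [|v vu].
  by rewrite addr0 hc xiP eqxx; exact: cmul1l.
rewrite hc xiP ifF; first exact: cmul0l.
by apply: contra_neqF vu => /eqP uv; apply: val_inj.
Qed.

(** The difference x - truncation x E is orthogonal to the truncation, since their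
    coordinates have disjoint supports. *)
Lemma norm_truncation x (E : {fset T}) :
  `|x - truncation x E| ^+ 2 =
  `|hinner x x - partial_sum (fun t => hinner (coord x t) (coord x t)) E|.
Proof.
have [lc hc _ _ _] := M_sum.
set z := x - truncation x E; pose P := hinner x (truncation x E).
have -> : partial_sum (fun t => hinner (coord x t) (coord x t)) E = P.
  rewrite /P hinner_sumr; apply: eq_bigr => u _.
  by rewrite hinner_act -(star_hinner (xi _)) hinner_xi.
have zE : hinner z (truncation x E) = 0.
  rewrite hinner_sumr big1// => u _.
  rewrite hinner_act -(star_hinner (xi _)) hinner_xi (linear_funB (lc _)).
  by rewrite coord_truncation subrr star0 cmul0l.
rewrite norm_hinner -[z in hinner z z]/(x - truncation x E) hinnerBr zE subr0.
by rewrite -star_hinner norm_cstar hinnerBr.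
Qed.

Lemma truncation_cvg x : truncation x @ totally --> x.
Proof.
have [_ _ _ _ /(_ x x) Px] := M_sum.
have tF := @totally_filter T.
apply/cvgrPdist_lt => e e0.
have /cvgrPdist_lt/(_ (e ^+ 2) (exprn_gt0 2 e0)) := Px.
apply: filterS => E; rewrite -norm_truncation.
by rewrite ltr_pXn2r// ?nnegrE// ltW.
Qed.

End DirectSum.

(** * Cyclic vectors of the interior tensor product *)

Section TensorProduct.
Variables (R : realType) (B : cstarAlgType R) (T : choiceType).
Variables (M : hilbertModType B) (coord : M -> T -> standard_module B).
Hypothesis M_sum : is_direct_sum coord.
Variable xi : T -> M.
Hypothesis xiP : forall t u, coord (xi t) u = if u == t then cone else 0.
Variables (rho : B -> R[i]) (rho_state : is_state rho).
Variables (H' : hilbertType R) (pi' : B -> H' -> H') (xi_rho : H').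
Hypothesis gns : is_gns rho pi' xi_rho.
Variables (H : hilbertType R) (tens : M -> H' -> H).
Hypothesis H_tensor : is_tensor_product pi' tens.

(** The vectors on which the theorem prescribes V s, indexed by pairs (t, y). *)
Definition elementary (p : T * B) : H := tens (hact (xi p.1) p.2) xi_rho.

Lemma elementary_gram p q :
  inner (elementary p) (elementary q) =
  if p.1 == q.1 then rho (star q.2 *c p.2) else 0.
Proof.
have [_ _ _ tensE _] := H_tensor; have [_ _ rhoE] := gns.
have [rho_lin _ _ _] := rho_state.
have [_ hc _ _ _] := M_sum.
rewrite tensE rhoE hinner_act -(star_hinner (xi _)) (hinner_xi M_sum xiP) hc xiP.
case: eqP => [_|_]; first by rewrite -[hact _ _]/(cone *c _) cmul1l.
rewrite -[hact _ _]/(0 *c _) cmul0l star0 cmul0l.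
exact: (linear_fun0 rho_lin).
Qed.

Let span := family_span elementary.

Lemma spanD x y : span x -> span y -> span (x + y).
Proof. by move=> [s ->] [t ->]; exists (s ++ t); rewrite big_cat. Qed.

Lemma span0 : span 0.
Proof. by exists [::]; rewrite big_nil. Qed.

Let clD x y : closure span x -> closure span y -> closure span (x + y).
Proof.
move=> /closure_normP cx /closure_normP cy; apply/closure_normP => e e0.
have e20 : 0 < e / 2 by rewrite divr_gt0.
have [a Sa xa] := cx _ e20; have [b Sb yb] := cy _ e20.
exists (a + b); first exact: spanD.
rewrite opprD addrACA; apply: le_lt_trans (ler_normD _ _) _.
by rewrite [e]splitr ltrD.
Qed.

Let norm_tens_cyclic x : `|tens x xi_rho| <= `|x|.
Proof.
have [_ _ _ tensE _] := H_tensor; have [_ _ rhoE] := gns.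
have [_ _ rho_le _] := rho_state.
rewrite -(@ler_pXn2r _ 2) ?nnegrE// -[leLHS]ger0_norm ?exprn_ge0//.
by rewrite norm_inner tensE rhoE norm_hinner.
Qed.

Let norm_tens x h : `|tens x h| <= `|x| * `|h|.
Proof.
have [_ _ _ tensE _] := H_tensor; have [rep _ _] := gns.
rewrite -(@ler_pXn2r _ 2) ?nnegrE ?mulr_ge0// -[leLHS]ger0_norm ?exprn_ge0//.
rewrite norm_inner tensE exprMn norm_hinner (expr2 `|h|) mulrA.
apply: le_trans (cauchy_schwarz _ _) _; rewrite ler_wpM2r//.
exact: (gns_contractive rep rho_state gns).
Qed.

Let cl_tens_cyclic x : closure span (tens x xi_rho).
Proof.
have [tl _ _ _ _] := H_tensor; have tF := @totally_filter T.
apply/closure_normP => e e0.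
have /cvgrPdist_lt/(_ e e0)/filter_ex[E xE] :
    truncation coord xi x @ totally --> x by exact: truncation_cvg.
exists (tens (truncation coord xi x E) xi_rho); last first.
  by rewrite -(linear_funB (tl _)); apply: le_lt_trans (norm_tens_cyclic _) xE.
rewrite /truncation (linear_fun_sum (tl _)).
apply: (big_ind span) => [||u _]; [exact: span0|exact: spanD|].
by exists [:: (1, (val u, coord x (val u)))]; rewrite big_seq1 scale1r.
Qed.

Let cl_tens x h : closure span (tens x h).
Proof.
have [_ tl tens_act _ _] := H_tensor; have [_ pi_dense _] := gns.
have x1 : 0 < `|x| + 1 by rewrite ltr_wpDl.
apply/closure_normP => e e0; have e20 : 0 < e / 2 by rewrite divr_gt0.
have [_ [y _ <-] hy] := (denseP _).1 pi_dense h _ (divr_gt0 e20 x1).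
have [d Sd yd] := (closure_normP _ _).1 (@cl_tens_cyclic (hact x y)) _ e20.
exists d => //; rewrite -(subrKA (tens x (pi' y xi_rho))).
apply: le_lt_trans (ler_normD _ _) _; rewrite [e]splitr -tens_act ler_ltD//.
rewrite tens_act -(linear_funB (tl _)); apply: le_trans (norm_tens _ _) _.
apply: le_trans (ler_wpM2l _ (ltW hy)) _ => //.
by rewrite mulrCA ger_pMr// ler_pdivrMr// mul1r lerDl.
Qed.

(** The closure of the span contains x (x) xi_rho by truncation of x, then
    x (x) pi' y xi_rho = (x y) (x) xi_rho, then every x (x) h because xi_rho is
    cyclic and tens x is continuous. *)
Lemma elementary_dense : dense (family_span elementary).
Proof.
have [_ _ _ _ /denseP tens_dense] := H_tensor.
apply/denseP => z e e0; have e20 : 0 < e / 2 by rewrite divr_gt0.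
have [_ [n [x [h ->]]] zd] := tens_dense z _ e20.
have : closure span (\sum_(j < n) tens (x j) (h j)).
  apply: (big_ind (closure span)) => [||j _]; [|exact: clD|exact: cl_tens].
  exact/subset_closure/span0.
move=> /closure_normP/(_ _ e20)[d Sd dd]; exists d => //.
rewrite -(subrKA (\sum_(j < n) tens (x j) (h j))).
by apply: le_lt_trans (ler_normD _ _) _; rewrite [e]splitr ltrD.
Qed.

End TensorProduct.

(** * The shift operators *)

Section CoreRepresentation.
Variables (R : realType) (S : monoidType).
Hypothesis S_lcm : right_lcm_semigroup S.
Variables (T : set S) (i : S -> T) (c : S -> core_monoid S).
Hypothesis T_transversal : transversal_core_equiv T.
Hypothesis icP : forall s, s = (val (i s) * val (c s))%g.
Variables (B : cstarAlgType R) (w : core_monoid S -> B).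
Hypothesis w_rep : lcm_representation w.
Variables (H : hilbertType R) (rho : B -> R[i]) (e : T -> B -> H).
Hypothesis e_gram : forall t u y z,
  inner (e t y) (e u z) = if t == u then rho (star z *c y) else 0.
Hypothesis e_dense : dense (family_span (fun p : T * B => e p.1 p.2)).

Let wK a y : star (w a) *c (w a *c y) = y.
Proof. by have [_ _ w1 _ _] := w_rep; rewrite cmulA w1 cmul1l. Qed.

Let i_inj s := @i_mul_inj S S_lcm T i c T_transversal icP s.

(** The candidate adjoint is chosen case by case on whether u is of the form
    i (s t); injectivity of t |-> i (s t) makes the choice irrelevant. *)
Lemma shift_operator s : exists V : bounded_operator H,
  [/\ forall (t : T) y, V (e t y) =
        e (i (s * val t)%g) (w (c (s * val t)%g) *c y),
      forall (t : T) z, op_adj V (e (i (s * val t)%g) z) =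
        e t (star (w (c (s * val t)%g)) *c z)
    & forall u z, (forall t : T, i (s * val t)%g <> u) -> op_adj V (e u z) = 0].
Proof.
pose g (p : T * B) := e (i (s * val p.1)%g) (w (c (s * val p.1)%g) *c p.2).
have [b bP] : exists b : T * B -> H, forall p,
    (exists2 t : T, i (s * val t)%g = p.1
       & b p = e t (star (w (c (s * val t)%g)) *c p.2)) \/
    (forall t : T, i (s * val t)%g <> p.1) /\ b p = 0.
  suff /choice[b bP] : forall p : T * B, exists h : H,
    (exists2 t : T, i (s * val t)%g = p.1
       & h = e t (star (w (c (s * val t)%g)) *c p.2)) \/
    (forall t : T, i (s * val t)%g <> p.1) /\ h = 0 by exists b.
  move=> p; have [[t tp]|np] := pselect (exists t : T, i (s * val t)%g = p.1).
    by exists (e t (star (w (c (s * val t)%g)) *c p.2)); left; exists t.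
  by exists 0; right; split=> // t tp; apply: np; exists t.
have i_eq (t u : T) : (i (s * val t)%g == i (s * val u)%g) = (t == u).
  by apply/eqP/eqP => [tu|->//]; exact: (i_inj tu).
have [|p q|V [Vg Vb]] := gram_operator e_dense (g := g) (b := b).
- move=> [t y] [u z]; rewrite /g /= !e_gram i_eq; case: eqP => [->|//].
  by rewrite starM -cmulA wK.
- case: p q => [t y] [u z]; rewrite /g /= e_gram.
  have [[t' /= ut' ->]|[/= nu ->]] := bP (u, z).
    rewrite e_gram -ut' i_eq; case: eqP => [->|//].
    by rewrite starM starK cmulA.
  by rewrite inner0r ifF//; apply/eqP/nu.
exists V; split=> [t y|t z|u z nu].
- exact: (Vg (t, y)).
- rewrite (Vb (_, z)).
  have [[t' /= tt -> /=]|[/= nt _]] := bP (i (s * val t)%g, z).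
    by rewrite (i_inj tt).
  by case: (nt t).
- by rewrite (Vb (u, z)); have [[t /= /nu//]|[]] := bP (u, z).
Qed.

Variable V : S -> bounded_operator H.
Hypothesis V_e : forall s (t : T) y,
  V s (e t y) = e (i (s * val t)%g) (w (c (s * val t)%g) *c y).
Hypothesis V_adj : forall s (t : T) z,
  op_adj (V s) (e (i (s * val t)%g) z) =
  e t (star (w (c (s * val t)%g)) *c z).
Hypothesis V_adj0 : forall s u z,
  (forall t : T, i (s * val t)%g <> u) -> op_adj (V s) (e u z) = 0.

Let op0 (W : bounded_operator H) : W 0 = 0.
Proof. exact/linear_fun0/op_linear. Qed.

(** All relations are compared on the vectors e t y. For a right LCM, both sides
    vanish at e r y unless i (s q) = i (t r) for some q; otherwise they are
    e (i (s' p)) (b y) with the two expressions of b equal by the LCM relation of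
    w in the core. *)
Lemma shift_lcm_representation : lcm_representation V.
Proof.
have [w1 wM _ w_lcm _] := w_rep.
split=> [|s r|s|s t s' t' lst est|s t st]; apply: (op_eq_dense e_dense) => -[r' y].
- rewrite /= V_e mul1g; have [-> ->] := ic_transversal S_lcm T_transversal icP r'.
  by rewrite w1 cmul1l.
- rewrite /= !V_e -mulgA.
  have [-> ->] := ic_mul S_lcm T_transversal icP s (r * val r')%g.
  by rewrite wM cmulA.
- by rewrite /= V_e V_adj wK.
- rewrite /= V_e.
  have [[q eq]|nq] := pselect (exists q : T, i (s * val q)%g = i (t * val r')%g).
    have [p [ps pt pc pl]] := i_mul_lcm S_lcm T_transversal icP lst est eq.
    rewrite -eq V_adj -pt V_adj V_e ps !cmulA pt.
    by rewrite (w_lcm _ _ _ _ pl pc).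
  (* A solution p of i (t' p) = r would give the solution q = i (s' p). *)
  rewrite V_adj0 => [|q eq]; last by apply: nq; exists q.
  rewrite V_adj0 ?op0// => p pr; apply: nq; exists (i (s' * val p)%g).
  have [<- _] := ic_mul S_lcm T_transversal icP s (s' * val p)%g.
  have := (ic_mul S_lcm T_transversal icP t (t' * val p)%g).1; rewrite pr => <-.
  by rewrite !mulgA est.
- rewrite /= V_e V_adj0// => q.
  exact: (i_mul_orthogonal S_lcm icP st).
Qed.

End CoreRepresentation.

(** * The representation of the semigroup C*-algebra *)

Theorem theorem8p4 (R : realType) (S : monoidType)
    (S_countable : countable [set: S])
    (S_lcm : right_lcm_semigroup S)
    (S_factorable : core_factorable S)
    (S_cap : core_irreducible_cap_closed S)
    (* the transversal and the maps i, c *)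
    (T : set S)
    (T_transversal : transversal_core_equiv T)
    (T_ci1 : forall t, T t -> core_irreducible1 t)
    (i : S -> T) (c : S -> core_monoid S)
    (icP : forall s, s = (val (i s) * val (c s))%g)
    (* C^*(S) and C^*(S_c) *)
    (A : cstarAlgType R) (v : S -> A)
    (A_univ : is_semigroup_cstar_algebra v)
    (B : cstarAlgType R) (w : core_monoid S -> B)
    (B_univ : is_semigroup_cstar_algebra w)
    (* M and the elements xi_t *)
    (M : hilbertModType B) (coord : M -> T -> standard_module B)
    (M_sum : is_direct_sum coord)
    (xi : T -> M)
    (xiP : forall t u, coord (xi t) u = if u == t then cone else 0)
    (* the state rho and its GNS representation *)
    (rho : B -> R[i]) (rho_state : is_state rho)
    (H' : hilbertType R) (pi' : B -> H' -> H') (xi_rho : H')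
    (gns : is_gns rho pi' xi_rho)
    (* H = M (x) H' *)
    (H : hilbertType R) (tens : M -> H' -> H)
    (H_tensor : is_tensor_product pi' tens) :
  exists V : S -> H -> H,
    [/\ forall s, unique (fun W : H -> H =>
          [/\ linear W, continuous W &
              forall (t : T) (y : B),
                W (tens (hact (xi t) y) xi_rho) =
                tens (hact (xi (i (s * val t)%g))
                           (w (c (s * val t)%g) *c y)) xi_rho]) (V s),
        forall s, adjointable (V s)
      & exists pi : A -> H -> H,
          is_representation pi /\ forall s, pi (v s) = V s].
Proof.
pose e (t : T) (y : B) := elementary xi xi_rho tens (t, y).
have e_gram (t u : T) y z :
    inner (e t y) (e u z) = if t == u then rho (star z *c y) else 0.
  exact: (elementary_gram M_sum xiP rho_state gns H_tensor).
have e_dense : dense (family_span (fun p : T * B => e p.1 p.2)).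
  have -> : (fun p => e p.1 p.2) = elementary xi xi_rho tens.
    by apply/funext => -[t y].
  exact: (elementary_dense M_sum xiP rho_state gns H_tensor).
have [w_rep _] := B_univ.
have /choice[V VP] :=
  shift_operator S_lcm T_transversal icP w_rep e_gram e_dense.
have V_e s (t : T) y :
    V s (e t y) = e (i (s * val t)%g) (w (c (s * val t)%g) *c y).
  by have [] := VP s.
have V_rep : lcm_representation V.
  apply: (shift_lcm_representation S_lcm T_transversal icP w_rep e_dense) => //.
    by move=> s t z; have [] := VP s.
  by move=> s u z; have [_ _] := VP s; apply.
have [_ /(_ _ V V_rep)[f [[[f_lin f1 fM f_star] fv] _]]] := A_univ.
exists V; split=> [s|s|].
- split; first by split; [exact: op_linear|exact: op_continuous|exact: V_e].
  move=> W [W_lin W_cont W_e].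
  apply: (linear_span_ext e_dense (op_linear _) W_lin (@op_continuous _ _ _) W_cont).
  by move=> [t y]; rewrite V_e; exact/esym/W_e.
- by exists (op_adj (V s)); exact: op_adjP.
- exists (fun a => f a : bounded_operator H); split=> [|s]; last by rewrite fv.
  split=> [a|k a b h|h|a b h|a h k].
  + exact: op_linear.
  + by rewrite f_lin.
  + by rewrite f1.
  + by rewrite fM.
  + by rewrite f_star op_adjP.
Qed.
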